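(* Let $G$ be a graph product of groups $G_i$, $1\le i\le n$, over a finite simplicial graph $\Lambda$ with vertices $v_1,\dots,v_n$ ($G_i$ attached to $v_i$), and let $X=\bigcup_{i=1}^nX_i$, where $X_i$ is a finite inverse-closed generating set for $G_i$ for each $i$. For each $i$ let $\Gamma_i:=\Gamma(G_i,X_i)$ be the geodesic language, $\widetilde\Gamma_i:=\widetilde\Gamma(G_i,X_i)$ the geodesic conjugacy language, and $$\widetilde U_i:=\{u_0\$u_1\cdots\$u_m \mid m\ge1\text{ and }u_1,\dots,u_{m-1},u_mu_0\in\Gamma_i\}$$ (with each $u_j\in X_i^*$). Let $y\in X^*$. The following are equivalent. (i) $y$ is a conjugacy geodesic for $G$ with respect to $X$. (ii) $y$ is a conjugationally trimmed word over $X$. (iii) $y\in\bigcap_{i=1}^n\pi_i^{-1}(\widetilde\Gamma_i\cup\widetilde U_i)$.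
   Context: Graph product: the group generated by the vertex groups, subject to the relations of the vertex groups together with the relations that elements of distinct adjacent vertex groups commute. The sets $X_i$ are regarded as pairwise disjoint sets of letters. For a group $K$ with finite inverse-closed generating set $Y$ and $g\in K$, $|g|$ is the length of a shortest word over $Y$ representing $g$, and $|g|_c:=\min\{|h| : h\text{ conjugate to }g\text{ in }K\}$. A word $w\in Y^*$ representing $g$ is a geodesic if its length $l(w)$ equals $|g|$, and a conjugacy geodesic if $l(w)=|g|_c$. $\Gamma(K,Y)$ is the set of all geodesics and $\widetilde\Gamma(K,Y)$ the set of all conjugacy geodesics. For $u,w\in X_i^*$ write $u=_{G_i}w$ if they represent the same element of $G_i$, and $u\sim_iw$ if they represent conjugate elements of $G_i$. Let $C_i$ be the union of those $X_j$ for which $v_j$ is adjacent to $v_i$ in $\Lambda$. For a word $w=a_1\cdots a_m$ with $a_k\in X_{j_k}$, let $C(w):=\bigcap_{k=1}^mC_{j_k}$ (so $C$ of the empty word is $X$). Operations on words over $X$ (with $y,z\in X^*$): (x0) Local reduction: $yuz\to ywz$ with $u,w\in X_i^*$, $u=_{G_i}w$, $l(u)>l(w)$. (x1) Local exchange: $yuz\to ywz$ with $u,w\in X_i^*$, $u=_{G_i}w$, $l(u)=l(w)$. (x2) Shuffle: $yuwz\to ywuz$ with $u\in X_i^*$, $w\in X_j^*$, and $v_i,v_j$ adjacent in $\Lambda$. (x3) Cyclic conjugation: $yz\to zy$. (x4) Conjugacy exchange: $uy\to wy$ with $u,w\in X_i^*$, $X_i\subseteq C(y)$, $u\sim_iw$,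 $l(u)=l(w)$. (x5) Conjugacy reduction: $uy\to wy$ with $u,w\in X_i^*$, $X_i\subseteq C(y)$, $u\sim_iw$, $l(u)>l(w)$. A word $y\in X^*$ is conjugationally trimmed if no finite sequence of operations of types (x0)–(x5) starting at $y$ ever contains an operation of type (x0) or (x5). For a letter $\$\notin X$, $\pi_i:X^*\to(X_i\cup\{\$\})^*$ is the monoid homomorphism with $\pi_i(a)=a$ if $a\in X_i$, $\pi_i(a)=\$$ if $a\in X\setminus(X_i\cup C_i)$, and $\pi_i(a)$ the empty word if $a\in C_i$. *)

(* Defs.v *)
From HB Require Import structures.
From mathcomp Require Import all_boot finmap boolp classical_sets.

Set Implicit Arguments.
Unset Strict Implicit.
Unset Printing Implicit Defensive.

Local Open Scope group_scope.
Local Open Scope quotient_scope.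

(* Geodesic languages of a group K.  The generating set is given by a type Y
   of letters with an evaluation ev : Y -> K, not assumed injective: in a graph
   product, identity letters taken from different vertex groups stay distinct
   letters although they represent the same element. *)

Definition least (P : nat -> Prop) : nat :=
  if pselect (exists k, `[< P k >]) is left exP then ex_minn exP else 0.

Definition conjugate (K : groupType) (g h : K) : Prop := exists c : K, h = g ^ c.

Section Geodesics.
Context (K : groupType) (Y : Type) (ev : Y -> K).
Implicit Types w : seq Y.

Definition word_val w : K := \prod_(a <- w) ev a.

(* Generation as a monoid: for an inverse-closed set of letters this is the
   same as generation as a group. *)
Definition generating : Prop := forall g : K, exists w, word_val w = g.

Definition glen (g : K) : nat :=
  least (fun k => exists2 w, word_val w = g & size w = k).

Definition gclen (g : K) : nat :=
  least (fun k => exists2 h, conjugate g h & glen h = k).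

Definition geodesics : set (seq Y) :=
  [set w | size w = glen (word_val w)]%classic.

Definition conj_geodesics : set (seq Y) :=
  [set w | size w = gclen (word_val w)]%classic.

End Geodesics.

(* The graph product, by its presentation: words in the disjoint union of the
   vertex groups, modulo the congruence generated by the defining relations. *)

Section GraphProduct.
Context (n : nat) (adj : rel 'I_n) (G : 'I_n -> groupType).
Local Notation syllable := {i : 'I_n & G i}.

Inductive gp_eq : seq syllable -> seq syllable -> Prop :=
| gp_one i : gp_eq [:: Tagged G (1 : G i)] [::]
| gp_mul i (a b : G i) : gp_eq [:: Tagged G a; Tagged G b] [:: Tagged G (a * b)]
| gp_comm i j (a : G i) (b : G j) of adj i j :
    gp_eq [:: Tagged G a; Tagged G b] [:: Tagged G b; Tagged G a]
| gp_refl u : gp_eq u u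
| gp_sym u v of gp_eq u v : gp_eq v u
| gp_trans u v w of gp_eq u v & gp_eq v w : gp_eq u w
| gp_cat u u' v v' of gp_eq u u' & gp_eq v v' : gp_eq (u ++ v) (u' ++ v').

Definition gp_eqb (u v : seq syllable) : bool := `[< gp_eq u v >].

Lemma gp_eqb_refl : reflexive gp_eqb.
Proof. by move=> u; apply/asboolP/gp_refl. Qed.

Lemma gp_eqb_sym : symmetric gp_eqb.
Proof. by move=> u v; apply/asboolP/asboolP; apply: gp_sym. Qed.

Lemma gp_eqb_trans : transitive gp_eqb.
Proof.
by move=> v u w /asboolP uv /asboolP vw; apply/asboolP/(gp_trans uv vw).
Qed.

Canonical gp_equiv := EquivRel gp_eqb gp_eqb_refl gp_eqb_sym gp_eqb_trans.

Definition graph_prod : Type := {eq_quot gp_equiv}.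

HB.instance Definition _ := Choice.on graph_prod.
HB.instance Definition _ := Quotient.on graph_prod.

Implicit Types (u v w : seq syllable) (x y z : graph_prod).

Definition gp_inv_word u : seq syllable :=
  rev [seq Tagged G (tagged (T_ := G) s)^-1 | s <- u].

Definition gp_unit : graph_prod := \pi_graph_prod [::].
Definition gp_prod x y : graph_prod := \pi_graph_prod (repr x ++ repr y).
Definition gp_inv x : graph_prod := \pi_graph_prod (gp_inv_word (repr x)).

Lemma gp_piP u v : (\pi_graph_prod u = \pi_graph_prod v) <-> gp_eq u v.
Proof. by split=> [/eqmodP/asboolP//|uv]; apply/eqmodP/asboolP. Qed.

Lemma gp_repr_pi u : gp_eq (repr (\pi_graph_prod u)) u.
Proof. by apply/gp_piP; rewrite reprK. Qed.

Lemma gp_prod_pi u v :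
  gp_prod (\pi_graph_prod u) (\pi_graph_prod v) = \pi_graph_prod (u ++ v).
Proof. by apply/gp_piP/gp_cat; apply: gp_repr_pi. Qed.

Lemma gp_inv_word_cat u v :
  gp_inv_word (u ++ v) = gp_inv_word v ++ gp_inv_word u.
Proof. by rewrite /gp_inv_word map_cat rev_cat. Qed.

Lemma gp_inv_wordK : involutive gp_inv_word.
Proof.
move=> u; rewrite /gp_inv_word map_rev revK -map_comp -[RHS]map_id.
by apply: eq_map => -[i a] /=; rewrite invgK.
Qed.

Lemma gp_mulVw u : gp_eq (gp_inv_word u ++ u) [::].
Proof.
elim: u => [|[i a] u IHu]; first exact: gp_refl.
rewrite -cat1s gp_inv_word_cat -catA [_ ++ [:: _] ++ u]catA.
apply: gp_trans IHu; apply: gp_cat; first exact: gp_refl.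
rewrite -[X in gp_eq _ X]cat0s; apply: gp_cat; last exact: gp_refl.
by apply: gp_trans (gp_mul _ _) _; rewrite mulVg; apply: gp_one.
Qed.

Lemma gp_mulwV u : gp_eq (u ++ gp_inv_word u) [::].
Proof. by rewrite -{1}[u]gp_inv_wordK; apply: gp_mulVw. Qed.

Lemma gp_prodA : associative gp_prod.
Proof.
elim/quotW => u; elim/quotW => v; elim/quotW => w.
by rewrite (gp_prod_pi v w) (gp_prod_pi u v) !gp_prod_pi catA.
Qed.

Lemma gp_prod1x : left_id gp_unit gp_prod.
Proof. by elim/quotW => u; rewrite gp_prod_pi. Qed.

Lemma gp_prodx1 : right_id gp_unit gp_prod.
Proof. by elim/quotW => u; rewrite gp_prod_pi cats0. Qed.

Lemma gp_prodVx : left_inverse gp_unit gp_inv gp_prod.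
Proof.
move=> x; rewrite -[X in gp_prod _ X]reprK gp_prod_pi.
exact/gp_piP/gp_mulVw.
Qed.

Lemma gp_prodxV : right_inverse gp_unit gp_inv gp_prod.
Proof.
move=> x; rewrite -[X in gp_prod X _]reprK gp_prod_pi.
exact/gp_piP/gp_mulwV.
Qed.

HB.instance Definition _ :=
  isGroup.Build graph_prod gp_prodA gp_prod1x gp_prodx1 gp_prodVx gp_prodxV.

Definition gp_inj i (a : G i) : graph_prod := \pi_graph_prod [:: Tagged G a].

End GraphProduct.

Section Letters.
Context (n : nat) (adj : rel 'I_n) (G : 'I_n -> groupType).
Context (X : forall i, {fset G i}).

(* The disjoint union of the X i. *)
Definition letter : finType := {i : 'I_n & X i}.

Implicit Types (y z : seq letter).

Definition vertex_val i : X i -> G i := val.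

Definition letter_val (a : letter) : graph_prod adj G :=
  gp_inj adj (vertex_val (tagged a)).

Definition lift_word i (u : seq (X i)) : seq letter :=
  [seq Tagged (fun j => X j) a | a <- u].

Definition Xset i : {set letter} := [set a : letter | tag a == i]%SET.

Definition Cset i : {set letter} := (\bigcup_(j | adj i j) Xset j)%SET.

Definition Cword y : {set letter} := (\bigcap_(a <- y) Cset (tag a))%SET.

Definition eqG i (u w : seq (X i)) : Prop :=
  word_val (vertex_val (i := i)) u = word_val (vertex_val (i := i)) w.

Definition conjG i (u w : seq (X i)) : Prop :=
  conjugate (word_val (vertex_val (i := i)) u) (word_val (vertex_val (i := i)) w).

Inductive op_kind :=
  | LocalReduction | LocalExchange | Shuffle
  | CyclicConjugation | ConjugacyExchange | ConjugacyReduction.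

Inductive operation : op_kind -> seq letter -> seq letter -> Prop :=
| Op_local_reduction y z i (u w : seq (X i)) of eqG u w & size u > size w :
    operation LocalReduction
      (y ++ lift_word u ++ z) (y ++ lift_word w ++ z)
| Op_local_exchange y z i (u w : seq (X i)) of eqG u w & size u = size w :
    operation LocalExchange
      (y ++ lift_word u ++ z) (y ++ lift_word w ++ z)
| Op_shuffle y z i j (u : seq (X i)) (w : seq (X j)) of adj i j :
    operation Shuffle
      (y ++ lift_word u ++ lift_word w ++ z)
      (y ++ lift_word w ++ lift_word u ++ z)
| Op_cyclic_conjugation y z :
    operation CyclicConjugation (y ++ z) (z ++ y)
| Op_conjugacy_exchange y i (u w : seq (X i)) of
    Xset i \subset Cword y & conjG u w & size u = size w :
    operation ConjugacyExchange (lift_word u ++ y) (lift_word w ++ y)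
| Op_conjugacy_reduction y i (u w : seq (X i)) of
    Xset i \subset Cword y & conjG u w & size u > size w :
    operation ConjugacyReduction (lift_word u ++ y) (lift_word w ++ y).

(* s lists the successive operations applied, starting at y, each with its
   type and the word it produces. *)
Fixpoint operation_sequence y (s : seq (op_kind * seq letter)) : Prop :=
  if s is (k, z) :: s' then operation k y z /\ operation_sequence z s'
  else True.

Definition reducing (k : op_kind) : bool :=
  match k with LocalReduction | ConjugacyReduction => true | _ => false end.

Definition conj_trimmed y : Prop :=
  forall s, operation_sequence y s -> ~~ has (fun kz => reducing kz.1) s.

(* Words over X i extended by the letter $, which is None. *)

Definition proj_letter i (a : letter) : seq (option (X i)) :=
  untag (if a \in Cset i then [::] else [:: None])
        (fun x : X i => [:: Some x]) a.

Definition proj i y : seq (option (X i)) := flatten [seq proj_letter i a | a <- y].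

Definition Gamma i : set (seq (X i)) := geodesics (@vertex_val i).

Definition cGamma i : set (seq (X i)) := conj_geodesics (@vertex_val i).

(* u_0 $ u_1 $ ... $ u_m, where us = u_1, ..., u_(m-1) and um = u_m; the
   condition m >= 1 is built into rcons us um. *)
Definition cU i : set (seq (option (X i))) :=
  [set v | exists u0 us um,
     [/\ v = map Some u0 ++ flatten [seq None :: map Some u | u <- rcons us um],
         forall u, u \in us -> Gamma u
       & Gamma (um ++ u0)]]%classic.

(* cGamma i, seen as a language over X i extended by $. *)
Definition cGamma_dollar i : set (seq (option (X i))) :=
  (map Some @` cGamma (i := i))%classic.

End Letters.

Arguments vertex_val {n G} X i.
Arguments letter_val {n} adj {G} X.
Arguments Gamma {n G} X i.
Arguments cGamma {n G} X i.
Arguments cU {n G} X i.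
Arguments cGamma_dollar {n G} X i.

(* Main.v *)
Require Import Defs.
From mathcomp Require Import all_boot finmap boolp classical_sets.

(* (i) => (ii): no operation lengthens a word or leaves its conjugacy class.
   (ii) => (iii): cyclic conjugation and shuffles bring any factor of pi_i(y)
   between two $ (cyclically) to the front as a subword over X_i, where a
   non-geodesic could be shortened; without $, a conjugacy reduction applies.
   (iii) => (i): if all the $-free factors of all the pi_i(z) are geodesic, then z
   is geodesic; this follows from the normal forms of a graph product (reduced
   syllable words up to shuffling). Let I be the set of the vertices i such that
   pi_i(y) has no $. For i in I, the retraction onto G_i shows that every w
   conjugate to y has at least as many letters in X_i as y. Deleting the letters
   at the vertices of I from y leaves a word y' all of whose powers are geodesic,
   and then y' has minimal length in its conjugacy class, because the length of
   the k-th power of any conjugate differs from k |y'| by a bounded amount. *)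

Set Implicit Arguments.
Unset Strict Implicit.
Unset Printing Implicit Defensive.

Local Open Scope group_scope.

Lemma untag_Tagged (I : eqType) (T : I -> Type) (R : Type) (idx : R) (i : I)
    (F : T i -> R) (a : T i) :
  untag idx F (Tagged T a) = F a.
Proof. exact: (untagE idx F (u := Tagged T a) (erefl i)). Qed.

(** * Normal forms of a graph product: reduced syllable words up to shuffling *)

Section NormalForm.
Context (n : nat) (adj : rel 'I_n) (G : 'I_n -> groupType).
Context (adj_irr : irreflexive adj) (adj_sym : symmetric adj).
Local Notation syllable := {i : 'I_n & G i}.
Implicit Types (s t : syllable) (u v w : seq syllable).

Lemma adj_neq i j : adj i j -> i != j.
Proof. by apply: contraTneq => ->; rewrite adj_irr. Qed.

Inductive shuffle_eq : seq syllable -> seq syllable -> Prop :=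
| shuffle_refl w : shuffle_eq w w
| shuffle_swap s t w of adj (tag s) (tag t) :
    shuffle_eq [:: s, t & w] [:: t, s & w]
| shuffle_cons s u v of shuffle_eq u v : shuffle_eq (s :: u) (s :: v)
| shuffle_trans u v w of shuffle_eq u v & shuffle_eq v w : shuffle_eq u w.

Lemma shuffle_sym u v : shuffle_eq u v -> shuffle_eq v u.
Proof.
elim=> {u v} [w|s t w st|s u v _ vu|u v w _ vu _ wv].
- exact: shuffle_refl.
- by apply: shuffle_swap; rewrite adj_sym.
- exact: shuffle_cons.
- exact: shuffle_trans wv vu.
Qed.

(* The syllable of vertex i that can be shuffled to the front (1 if there is
   none), and what remains of the word without it. *)
Fixpoint hd i w : G i :=
  if w is s :: w' then
    untag (if adj i (tag s) then hd i w' else 1) id s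
  else 1.

Fixpoint rm i w : seq syllable :=
  if w is s :: w' then
    if tag s == i then w' else if adj i (tag s) then s :: rm i w' else w
  else [::].

Lemma hd_eq i (a : G i) w : hd i (Tagged G a :: w) = a.
Proof. exact: untag_Tagged. Qed.

Lemma hd_neq i s w : tag s != i ->
  hd i (s :: w) = if adj i (tag s) then hd i w else 1.
Proof. exact: untag_dflt. Qed.

Lemma hd_adj i s w : adj i (tag s) -> hd i (s :: w) = hd i w.
Proof. by move=> is_; rewrite hd_neq ?is_ // eq_sym adj_neq. Qed.

Lemma rm_eq i (a : G i) w : rm i (Tagged G a :: w) = w.
Proof. by rewrite /= eqxx. Qed.

Lemma rm_adj i s w : adj i (tag s) -> rm i (s :: w) = s :: rm i w.
Proof. by move=> is_; rewrite /= is_ eq_sym (negPf (adj_neq is_)). Qed.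

(** A swap involves adjacent vertices, so if one of the two syllables sits at [i], the other one
    does not block it. *)
Lemma hd_shuffle i u v : shuffle_eq u v -> hd i u = hd i v.
Proof.
elim=> {u v} [//|s t w|s u v _ IH|u v w _ -> _ //]; last first.
  by rewrite /= IH.
case: s t => j a [k b] jk; rewrite /= in jk.
have [ji|ji] := eqVneq j i.
  by subst j; rewrite hd_eq hd_adj ?hd_eq.
have [ki|ki] := eqVneq k i.
  by subst k; rewrite hd_eq hd_adj ?hd_eq // adj_sym.
by rewrite !hd_neq //=; case: (adj i j); case: (adj i k).
Qed.

Lemma rm_shuffle i u v : shuffle_eq u v -> shuffle_eq (rm i u) (rm i v).
Proof.
elim=> {u v} [w|s t w|s u v uv IH|u v w _ uv _ vw].
- exact: shuffle_refl.
- case: s t => j a [k b] /= jk.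
  have [ji|ji] := eqVneq j i.
    by subst j; rewrite jk eq_sym (negPf (adj_neq jk)); apply: shuffle_refl.
  have [ki|ki] := eqVneq k i.
    by subst k; rewrite adj_sym jk; apply: shuffle_refl.
  case ij: (adj i j); case ik: (adj i k);
    by try apply: shuffle_cons; try apply: shuffle_swap; try apply: shuffle_refl.
- rewrite /=; case: ifP => // _; case: ifP => // _; exact: shuffle_cons.
- exact: shuffle_trans uv vw.
Qed.

(** Trivial syllables are dropped, so that reducedness survives a cancellation. *)
Definition scons i (a : G i) w := if a == 1 then w else Tagged G a :: w.

(* Left multiplication by s on reduced words; [push_word_eq] says that this is an
   action of the graph product on reduced words up to shuffling. *)
Definition push s w := scons (tagged s * hd (tag s) w) (rm (tag s) w).

Definition push_word u w := foldr push w u.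

Lemma scons_shuffle i (a : G i) u v :
  shuffle_eq u v -> shuffle_eq (scons a u) (scons a v).
Proof. by rewrite /scons; case: ifP => // _; apply: shuffle_cons. Qed.

Lemma push_shuffle s u v : shuffle_eq u v -> shuffle_eq (push s u) (push s v).
Proof.
move=> uv; rewrite /push (hd_shuffle _ uv).
exact/scons_shuffle/rm_shuffle.
Qed.

Lemma push_word_shuffle x u v :
  shuffle_eq u v -> shuffle_eq (push_word x u) (push_word x v).
Proof. by move=> uv; elim: x => //= s x; apply: push_shuffle. Qed.

(** A syllable at [i] is blocked by any earlier one whose vertex is not adjacent to [i]; behind such
    a syllable nothing is left to check. *)
Fixpoint unreachable i w : bool :=
  if w is s :: w' then
    (tag s != i) && (adj i (tag s) ==> unreachable i w')
  else true.

Fixpoint reduced w : bool :=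
  if w is s :: w' then
    [&& tagged s != 1, unreachable (tag s) w' & reduced w']
  else true.

Lemma unreachable_hd i w : unreachable i w -> hd i w = 1.
Proof.
elim: w => // s w IH /andP[si /implyP aw].
by rewrite hd_neq //; case: ifP => // /aw /IH.
Qed.

Lemma unreachable_rm i w : unreachable i w -> rm i w = w.
Proof.
elim: w => // s w IH /= /andP[/negPf-> /implyP aw].
by case: ifP => // /aw /IH ->.
Qed.

(** Reducedness allows at most one reachable syllable at [i]: the later ones are blocked by
    something other than the one removed. *)
Lemma rm_unreachable i w : reduced w -> unreachable i (rm i w).
Proof.
elim: w => // -[j a] w IH /= /and3P[_ jw /IH iw].
have [ji|ji] := eqVneq j i; first by subst j.
case ij: (adj i j) => /=; first by rewrite ji iw implybT.
by rewrite ji ij.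
Qed.

(** Only vertices that are not adjacent to [j] block [j], so taking out a syllable at [i] unblocks
    nothing. *)
Lemma rm_unreachable_adj i j w :
  adj i j -> unreachable j w -> unreachable j (rm i w).
Proof.
move=> ij; elim: w => // -[k a] w IH /= /andP[kj /implyP jkw].
have [ki|ki] := eqVneq k i; first by subst k; apply: jkw; rewrite adj_sym.
case: (adj i k) => /=; last by rewrite kj; apply/implyP.
by rewrite kj; apply/implyP => /jkw /IH.
Qed.

Lemma rm_reduced i w : reduced w -> reduced (rm i w).
Proof.
elim: w => // -[j a] w IH /= /and3P[a1 jw rw].
case: eqP => // _; case: ifP => /= [ij|_]; last by rewrite a1 jw.
by rewrite a1 IH // rm_unreachable_adj.
Qed.

Lemma hd_rm_adj i j w : adj i j -> hd j (rm i w) = hd j w.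
Proof.
move=> ij; elim: w => // -[k a] w IH.
have [ki|ki] := eqVneq k i; first by subst k; rewrite rm_eq hd_adj // adj_sym.
case ik: (adj i k); last by rewrite /= (negPf ki) ik.
by rewrite rm_adj //= IH.
Qed.

Lemma rm_rm_adj i j w : adj i j -> rm i (rm j w) = rm j (rm i w).
Proof.
move=> ij; have ji : adj j i by rewrite adj_sym.
elim: w => // -[k a] w IH.
have [ki|ki] := eqVneq k i; first by subst k; rewrite (rm_adj (i := j)) // !rm_eq.
have [kj|kj] := eqVneq k j; first by subst k; rewrite (rm_adj (i := i)) // !rm_eq.
rewrite /= (negPf ki) (negPf kj).
case ik: (adj i k); case jk: (adj j k) => //=.
- by rewrite (negPf ki) (negPf kj) ik jk IH.
- by rewrite (negPf ki) (negPf kj) ik jk.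
- by rewrite (negPf ki) (negPf kj) ik jk.
- by rewrite (negPf ki) (negPf kj) ik jk.
Qed.

Lemma scons_reduced i (a : G i) w :
  unreachable i w -> reduced w -> reduced (scons a w).
Proof. by move=> iw rw; rewrite /scons; case: eqP => //= /eqP->; rewrite iw. Qed.

Lemma push_reduced s w : reduced w -> reduced (push s w).
Proof.
by move=> rw; apply: scons_reduced; [apply: rm_unreachable|apply: rm_reduced].
Qed.

Lemma push_word_reduced u w : reduced w -> reduced (push_word u w).
Proof. by move=> rw; elim: u => //= s u; apply: push_reduced. Qed.

(** The syllable taken out travels back past syllables adjacent to it. Reducedness excludes a
    trivial one, which [scons] would not restore. *)
Lemma scons_hd_rm i w : reduced w -> shuffle_eq (scons (hd i w) (rm i w)) w.
Proof.
elim: w => [|[j a] w IH] rw.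
  by rewrite /scons eqxx; apply: shuffle_refl.
have [a1 jw rw'] : [/\ a != 1, unreachable j w & reduced w] by case/and3P: rw.
have [ji|ji] := eqVneq j i.
  by subst j; rewrite hd_eq rm_eq /scons (negPf a1); apply: shuffle_refl.
case ij: (adj i j); last first.
  by rewrite hd_neq //= ij (negPf ji) /scons eqxx; apply: shuffle_refl.
rewrite hd_adj // rm_adj //.
apply: (@shuffle_trans _ (Tagged G a :: scons (hd i w) (rm i w))).
  by rewrite /scons; case: ifP => _; [apply: shuffle_refl|apply: shuffle_swap].
exact/shuffle_cons/IH.
Qed.

Lemma hd_scons i (a : G i) w : unreachable i w -> hd i (scons a w) = a.
Proof.
move=> iw; rewrite /scons; case: eqP => [->|_]; last exact: hd_eq.
exact: unreachable_hd.
Qed.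

Lemma rm_scons i (a : G i) w : unreachable i w -> rm i (scons a w) = w.
Proof.
move=> iw; rewrite /scons; case: eqP => [_|_]; last exact: rm_eq.
exact: unreachable_rm.
Qed.

Lemma hd_push i (a : G i) w :
  reduced w -> hd i (push (Tagged G a) w) = a * hd i w.
Proof. by move=> rw; rewrite hd_scons // rm_unreachable. Qed.

Lemma hd_scons_adj i j (a : G j) w : adj i j -> hd i (scons a w) = hd i w.
Proof. by move=> ij; rewrite /scons; case: ifP => // _; rewrite hd_adj. Qed.

Lemma rm_scons_adj i j (a : G j) w :
  adj i j -> rm i (scons a w) = scons a (rm i w).
Proof. by move=> ij; rewrite /scons; case: ifP => // _; rewrite rm_adj. Qed.

Lemma push1 i w : reduced w -> shuffle_eq (push (Tagged G (1 : G i)) w) w.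
Proof. by move=> rw; rewrite /push /= mul1g; apply: scons_hd_rm. Qed.

Lemma pushM i (a b : G i) w : reduced w ->
  push (Tagged G a) (push (Tagged G b) w) = push (Tagged G (a * b)) w.
Proof.
move=> rw; rewrite {1}/push /= hd_push //.
by rewrite rm_scons ?rm_unreachable // mulgA.
Qed.

Lemma push_comm i j (a : G i) (b : G j) w : adj i j ->
  shuffle_eq (push (Tagged G a) (push (Tagged G b) w))
             (push (Tagged G b) (push (Tagged G a) w)).
Proof.
move=> ij; have ji : adj j i by rewrite adj_sym.
rewrite /push /= !hd_scons_adj // !rm_scons_adj // !hd_rm_adj // rm_rm_adj //.
rewrite /scons; case: ifP => _; case: ifP => _;
  by [apply: shuffle_refl|apply: shuffle_swap].
Qed.

(** Van der Waerden's argument: each defining relation is checked on the pushes. For [w] empty this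
    is the uniqueness of normal forms up to shuffling. *)
Lemma push_word_eq u v w : gp_eq adj u v -> reduced w ->
  shuffle_eq (push_word u w) (push_word v w).
Proof.
move=> uv; elim: uv w => {u v} [i|i a b|i j a b ij|u|u v _ IH|u v x _ IH1 _ IH2|
    u u' v v' _ IH1 _ IH2] w rw /=.
- exact: push1.
- by rewrite pushM //; apply: shuffle_refl.
- exact: push_comm.
- exact: shuffle_refl.
- exact/shuffle_sym/IH.
- exact: shuffle_trans (IH1 _ rw) (IH2 _ rw).
- rewrite /push_word !foldr_cat -!/(push_word _ _).
  by apply: shuffle_trans (IH1 _ (push_word_reduced v rw)) _;
    apply/push_word_shuffle/IH2.
Qed.

End NormalForm.

(** * Length and conjugacy length in a group *)

Section LengthFunction.
Context (K : groupType) (Y : Type) (ev : Y -> K).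
Implicit Types (w : seq Y) (g h : K).

Lemma least_le (P : nat -> Prop) k : P k -> least P <= k.
Proof.
move=> Pk; rewrite /least; case: pselect => [exP|//].
by case: ex_minnP => m _; apply; apply/asboolP.
Qed.

Lemma leastP (P : nat -> Prop) k : P k -> P (least P).
Proof.
move=> Pk; rewrite /least; case: pselect => [exP|[]].
  by case: ex_minnP => m /asboolP.
by exists k; apply/asboolP.
Qed.

Lemma word_val_cat u w : word_val ev (u ++ w) = word_val ev u * word_val ev w.
Proof. exact: big_cat. Qed.

Lemma word_val_cons a w : word_val ev (a :: w) = ev a * word_val ev w.
Proof. exact: big_cons. Qed.

Lemma glen_le w : glen ev (word_val ev w) <= size w.
Proof. by apply: least_le; exists w. Qed.

Lemma glen1 : glen ev 1 = 0.
Proof.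
by apply/eqP; rewrite -leqn0 -[1](big_nil _ _ _ _ : word_val ev [::] = 1) glen_le.
Qed.

Lemma gclen_le_glen g h : conjugate g h -> gclen ev g <= glen ev h.
Proof. by move=> gh; apply: least_le; exists h. Qed.

Lemma gclen_attained g : exists2 h, conjugate g h & glen ev h = gclen ev g.
Proof.
apply: (@leastP (fun k => exists2 h, conjugate g h & glen ev h = k) (glen ev g)).
by exists g => //; exists 1; rewrite conjg1.
Qed.

Lemma geodesic_nil : geodesics ev [::].
Proof. by rewrite /geodesics /= /word_val big_nil glen1. Qed.

Context (gen : generating ev).

Lemma glen_attained g : exists2 w, word_val ev w = g & size w = glen ev g.
Proof.
have [w wg] := gen g.
apply: (@leastP (fun k => exists2 w, word_val ev w = g & size w = k) (size w)).
by exists w.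
Qed.

Lemma glenM g h : glen ev (g * h) <= glen ev g + glen ev h.
Proof.
have [[u <- <-] [w <- <-]] := (glen_attained g, glen_attained h).
by rewrite -word_val_cat -size_cat glen_le.
Qed.

Lemma geodesic_catl u w : geodesics ev (u ++ w) -> geodesics ev u.
Proof.
rewrite /geodesics /= word_val_cat size_cat => uw.
apply/eqP; rewrite eqn_leq glen_le andbT.
have := glenM (word_val ev u) (word_val ev w); rewrite -uw => le.
by rewrite -(leq_add2r (size w)) (leq_trans le) // leq_add2l glen_le.
Qed.

Lemma geodesic_catr u w : geodesics ev (u ++ w) -> geodesics ev w.
Proof.
rewrite /geodesics /= word_val_cat size_cat => uw.
apply/eqP; rewrite eqn_leq glen_le andbT.
have := glenM (word_val ev u) (word_val ev w); rewrite -uw => le.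
by rewrite -(leq_add2l (size u)) (leq_trans le) // leq_add2r glen_le.
Qed.

Lemma not_geodesic w : ~ geodesics ev w ->
  exists2 u, word_val ev w = word_val ev u & size u < size w.
Proof.
move=> ngw; have [u uw su] := glen_attained (word_val ev w); exists u => //.
by rewrite su ltn_neqAle glen_le andbT; apply/eqP => e; apply: ngw.
Qed.

Lemma not_conj_geodesic w : ~ conj_geodesics ev w ->
  exists2 u, conjugate (word_val ev w) (word_val ev u) & size u < size w.
Proof.
move=> ngw; have [h wh hw] := gclen_attained (word_val ev w).
have [u uh su] := glen_attained h; exists u; first by rewrite uh.
rewrite su hw ltn_neqAle; apply/andP; split; first by apply/eqP => e; apply: ngw.
apply: leq_trans (glen_le w); apply: gclen_le_glen; exists 1.
by rewrite conjg1.
Qed.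

Lemma conj_geodesicP w :
  (forall u, conjugate (word_val ev w) (word_val ev u) -> size w <= size u) ->
  conj_geodesics ev w.
Proof.
move=> minw; apply: contrapT => /not_conj_geodesic[u wu].
by rewrite ltnNge minw.
Qed.

End LengthFunction.

Lemma conj_geodesic_le (K : groupType) (Y : Type) (ev : Y -> K) u w :
  conj_geodesics ev u -> conjugate (word_val ev u) (word_val ev w) ->
  size u <= size w.
Proof. by move=> -> uw; apply: leq_trans (gclen_le_glen ev uw) (glen_le ev w). Qed.

Lemma val_flatten_nseq (K : groupType) (Y : Type) (ev : Y -> K) k y :
  word_val ev (flatten (nseq k y)) = word_val ev y ^+ k.
Proof.
elim: k => [|k IH]; first exact: big_nil.
by rewrite /= word_val_cat IH expgS.
Qed.

(* If h = c^-1 g c, then g^k = c h^k c^-1 has length at most k |w| + O(1) for any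
   word w representing h; compare with the length k |y| and let k grow. *)
Lemma geodesic_powers_min (K : groupType) (Y : Type) (ev : Y -> K) y w :
    generating ev -> (forall k, geodesics ev (flatten (nseq k y))) ->
  conjugate (word_val ev y) (word_val ev w) -> size y <= size w.
Proof.
move=> gen gy [c wE]; have [[d dc] [d' dc']] := (gen c, gen c^-1).
rewrite leqNgt; apply/negP => lt_wy.
have size_pow k (x : seq Y) : size (flatten (nseq k x)) = (k * size x)%N.
  by elim: k => //= k IH; rewrite size_cat IH mulSn.
have le_pow k : k * size y <= size d + (k * size w + size d').
  rewrite -!size_pow gy; have -> : word_val ev (flatten (nseq k y)) =
      word_val ev (d ++ flatten (nseq k w) ++ d').
    rewrite !word_val_cat !val_flatten_nseq dc dc' wE -conjXg conjgE.
    by rewrite !mulgA mulgV mul1g mulgK.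
  by apply: leq_trans (glen_le _ _) _; rewrite !size_cat.
(* Saving at least one letter per period saves [k] letters in all, more than the constant
   [size d + size d']. *)
have := le_pow (size d + size d').+1; set k := _.+1.
rewrite addnCA leqNgt => /negP; apply.
apply: (@leq_trans (k * (size w).+1)); last by rewrite leq_mul2l lt_wy orbT.
by rewrite mulnS addnC ltn_add2r.
Qed.

Section Letters.
Context (n : nat) (adj : rel 'I_n) (G : 'I_n -> groupType).
Context (adj_irr : irreflexive adj) (adj_sym : symmetric adj).
Context (X : forall i : 'I_n, {fset G i}).
Context (X_gen : forall i : 'I_n, generating (vertex_val X i)).
Local Notation syllable := {i : 'I_n & G i}.
Local Notation glenG i := (glen (vertex_val X i)).
Local Notation valG i := (word_val (vertex_val X i)).
Local Notation val := (word_val (letter_val adj X)).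
Implicit Types (y z : seq (letter X)) (w : seq syllable).

Definition syl (a : letter X) : syllable := Tagged G (vertex_val X (tag a) (tagged a)).

Lemma word_val_pi y : val y = \pi_(graph_prod adj G)%qT [seq syl a | a <- y].
Proof.
elim: y => [|a y IH]; first exact: big_nil.
rewrite word_val_cons IH /= -cat1s; exact: gp_prod_pi.
Qed.

(** * Projections and their [$]-free factors *)

Fixpoint first_piece (T : Type) (v : seq (option T)) : seq T :=
  if v is Some x :: v' then x :: first_piece v' else [::].

Lemma first_piece_catl (T : Type) (u : seq T) v :
  first_piece (map Some u ++ v) = u ++ first_piece v.
Proof. by elim: u => //= a u ->. Qed.

Lemma first_piece_cat (T : eqType) (u v : seq (option T)) : None \in u ->
  first_piece (u ++ v) = first_piece u.
Proof. by elim: u => //= -[a|] u IH //= /IH ->. Qed.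

Lemma map_first_piece (T : eqType) (u : seq (option T)) : None \notin u ->
  map Some (first_piece u) = u.
Proof. by elim: u => //= -[a|] u IH //= /IH ->. Qed.

Lemma in_Cset i (a : letter X) : (a \in Cset adj X i) = adj i (tag a).
Proof.
apply/bigcupP/idP => [[j ij]|ia]; first by rewrite inE => /eqP->.
by exists (tag a); rewrite ?inE.
Qed.

Lemma proj_eq i (x : X i) y :
  proj adj i (Tagged (fun j => X j) x :: y) = Some x :: proj adj i y.
Proof. by rewrite /proj /= /proj_letter untag_Tagged. Qed.

Lemma proj_adj i (a : letter X) y : adj i (tag a) ->
  proj adj i (a :: y) = proj adj i y.
Proof.
move=> ia; rewrite /proj /= /proj_letter untag_dflt ?in_Cset ?ia //.
by rewrite eq_sym (adj_neq adj_irr).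
Qed.

Lemma proj_other i (a : letter X) y : tag a != i -> ~~ adj i (tag a) ->
  proj adj i (a :: y) = None :: proj adj i y.
Proof.
by move=> ai ia; rewrite /proj /= /proj_letter untag_dflt ?in_Cset ?(negPf ia).
Qed.

Lemma proj_cat i y z : proj adj i (y ++ z) = proj adj i y ++ proj adj i z.
Proof. by rewrite /proj map_cat flatten_cat. Qed.

(** * Lengths read off normal forms *)

Definition weight w := \sum_(s <- w) glenG (tag s) (tagged s).

Lemma weight_cons s w : weight (s :: w) = (glenG (tag s) (tagged s) + weight w)%N.
Proof. exact: big_cons. Qed.

Lemma weight_shuffle u w : shuffle_eq adj u w -> weight u = weight w.
Proof.
elim=> {u w} [//|s t w _|s u w _ IH|u v w _ -> _ -> //]; rewrite !weight_cons.
  by rewrite addnCA.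
by rewrite IH.
Qed.

Lemma weight_scons i (a : G i) w : weight (scons a w) = (glenG i a + weight w)%N.
Proof.
by rewrite /scons; case: eqP => [->|_]; rewrite ?glen1 ?weight_cons.
Qed.

Lemma weight_hd_rm i w : reduced adj w ->
  weight w = (glenG i (hd adj i w) + weight (rm adj i w))%N.
Proof.
by move=> rw; rewrite -weight_scons (weight_shuffle (scons_hd_rm adj_irr i rw)).
Qed.

Definition nf y := push_word adj [seq syl a | a <- y] [::].

Lemma nf_reduced y : reduced adj (nf y).
Proof. exact: push_word_reduced. Qed.

(** Pushing a letter changes only the reachable syllable at its vertex, whose length in the vertex
    group grows by at most one. *)
Lemma weight_nf_le y : weight (nf y) <= size y.
Proof.
elim: y => [|[i x] y IH]; first by rewrite /weight big_nil.
have -> : nf (existT _ i x :: y) = push adj (Tagged G (vertex_val X i x)) (nf y) by [].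
rewrite weight_scons /= -add1n.
apply: leq_trans (leq_add (leqnn 1) IH).
rewrite [in leqRHS](weight_hd_rm i) ?nf_reduced //.
rewrite addnA leq_add2r (leq_trans (glenM (@X_gen i) _ _)) // leq_add2r.
(* A letter has length at most one, being the value of a one-letter word. *)
by rewrite -[vertex_val _ _ _]mulg1 -[1](big_nil _ _ _ _ : valG i [::] = 1)
  -word_val_cons glen_le.
Qed.

(* The first pieces of the suffixes of y are the suffixes of the maximal $-free
   factors of proj i y. *)
Definition locally_geodesic y :=
  forall i u z, y = u ++ z -> Gamma X i (first_piece (proj adj i z)).

Lemma locally_geodesic_behead a y : locally_geodesic (a :: y) -> locally_geodesic y.
Proof. by move=> ay i u z e; apply: (ay i (a :: u)); rewrite e. Qed.

(** The claim on [hd] drives the induction: the syllable that a new letter meets is spelled by the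
    first piece, so local geodesicity makes its length grow by exactly one. *)
Lemma nf_locally_geodesic y : locally_geodesic y ->
  weight (nf y) = size y /\
  forall i, hd adj i (nf y) = valG i (first_piece (proj adj i y)).
Proof.
elim: y => [_|[i x] y IH gy].
  by split=> [|i]; rewrite /weight /word_val big_nil.
have [IHw IHhd] := IH (locally_geodesic_behead gy).
have := gy i [::] _ erefl.
have := gy i [:: existT _ i x] _ erefl.
rewrite -/(Tagged (fun j => X j) x) proj_eq /= /Gamma /geodesics /= word_val_cons.
have -> : nf (Tagged (fun j => X j) x :: y) =
          push adj (Tagged G (vertex_val X i x)) (nf y) by [].
rewrite -IHhd => gy' gxy.
(* A geodesic starting with [x] has positive length, so its value is not 1. The new syllable is
   therefore present and blocks the other vertices not adjacent to [i], whose first piece is empty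
   as well. *)
have hx1 : vertex_val X i x * hd adj i (nf y) != 1.
  by apply/eqP => h; move: gxy; rewrite h glen1.
split.
  rewrite weight_scons /= -gxy -IHw (weight_hd_rm i (nf_reduced y)).
  by rewrite gy' addSn.
move=> j; have [ij|ij] := eqVneq i j.
  by subst j; rewrite hd_push ?nf_reduced // proj_eq /= word_val_cons IHhd.
case ji: (adj j i).
  by rewrite hd_scons_adj // hd_rm_adj // 1?adj_sym // proj_adj.
rewrite proj_other //= ?ji // /push /scons (negPf hx1) hd_neq //= ji.
by rewrite /word_val big_nil.
Qed.

(** The two normal forms are shuffles of each other and share one weight, which equals [size y] and
    is at most [size z]. *)
Lemma locally_geodesic_min y z : locally_geodesic y -> val y = val z ->
  size y <= size z.
Proof.
move=> /nf_locally_geodesic[<- _]; rewrite !word_val_pi => /gp_piP yz.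
by rewrite (weight_shuffle (push_word_eq _ _ yz _)) // weight_nf_le.
Qed.

(* A suffix of v containing $ starts with a suffix of some u_j; the other ones are
   suffixes of u_m, and continue with u_0 when v is repeated cyclically. *)
Lemma cUP i v : cU X i v <->
  None \in v /\ forall m, Gamma X i (first_piece (drop m v ++ v)).
Proof.
pose F (us : seq (seq (X i))) := flatten [seq None :: map Some u | u <- us].
have pieces s : exists u0 us, s = map Some u0 ++ F us.
  elim: s => [|[x|] s [u0 [us ->]]]; first by exists [::], [::].
    by exists (x :: u0), us.
  by exists [::], (u0 :: us).
split=> [[u0 [us [um [-> us_geo u_geo]]]]|[None_v v_geo]].
  rewrite -/(F _); split.
    by rewrite mem_cat; case: us {us_geo} => [|? ?]; rewrite /= inE orbT.
  move=> m; set r := _ ++ F _.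
  have rE s : first_piece (map Some s ++ r) = s ++ u0.
    by rewrite /r !first_piece_catl; case: (us) => [|? ?] /=; rewrite cats0.
  have u0_geo := geodesic_catr (@X_gen i) u_geo.
  rewrite {1}/r; clearbody r.
  (* For the induction on [us] the initial factor becomes an arbitrary geodesic [s], while the copy
     [r] read after wrapping around stays fixed. *)
  suff S s : Gamma X i s ->
      Gamma X i (first_piece (drop m (map Some s ++ F (rcons us um)) ++ r)).
    exact: S.
  elim: us us_geo s m => [|u us IH] us_geo s m s_geo; rewrite drop_cat size_map.
    case: ltnP => _.
      rewrite -map_drop -catA first_piece_catl /= cats0.
      by move: s_geo; rewrite -{1}(cat_take_drop m s); apply: geodesic_catr.
    rewrite /F /= cats0; case: (m - _)%N => [|k] /=; first exact: geodesic_nil.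
    rewrite -map_drop rE.
    move: u_geo; rewrite -{1}(cat_take_drop k um) -catA; exact: geodesic_catr.
  case: ltnP => _.
    rewrite -map_drop -catA first_piece_catl /= cats0.
    by move: s_geo; rewrite -{1}(cat_take_drop m s); apply: geodesic_catr.
  rewrite /F /= -/(F _); case: (m - _)%N => [|k] /=; first exact: geodesic_nil.
  apply: IH => [w wus|]; first by apply: us_geo; rewrite inE wus orbT.
  by apply: us_geo; rewrite inE eqxx.
have [u0 [us vE]] := pieces v.
case/lastP: us vE => [|us um] vE.
  by move: None_v; rewrite vE cats0 => /mapP[].
have fv : first_piece v = u0.
  by rewrite vE first_piece_catl; case: (us) => [|? ?] /=; rewrite cats0.
have v_geo' a b : v = a ++ b -> Gamma X i (first_piece (b ++ v)).
  by move=> e; have := v_geo (size a); rewrite {1}e drop_size_cat.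
exists u0, us, um; split=> //.
  move=> u /splitPr us_u; case: us_u vE => us1 us2 vE.
  have e : v = (map Some u0 ++ F us1 ++ [:: None]) ++ (map Some u ++ F (rcons us2 um)).
    by rewrite vE /F rcons_cat map_cat flatten_cat /= -!catA.
  have := v_geo' _ _ e; rewrite -[(_ ++ F _) ++ v]catA first_piece_catl.
  by rewrite /F; case: (us2) => [|? ?] /=; rewrite cats0.
have e : v = (map Some u0 ++ F us ++ [:: None]) ++ map Some um.
  by rewrite vE /F map_rcons -cats1 flatten_cat /= cats0 -!catA.
by have := v_geo' _ _ e; rewrite first_piece_catl fv.
Qed.

(** * From trimmed words to the projections *)

Lemma trimmed_step k y z : conj_trimmed adj y -> operation adj k y z ->
  ~~ reducing k /\ conj_trimmed adj z.
Proof.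
move=> ty yz; split; first by have := ty [:: (k, z)] (conj yz I); rewrite /= orbF.
by move=> s zs; have /norP[] := ty ((k, z) :: s) (conj yz zs).
Qed.

(** Each letter of [C_i] met before the first [$] is shuffled to the right past the letters of [X_i]
    that follow it; if there is no [$], only such letters remain in [r]. In the induction, [x]
    absorbs the letters already read. *)
Lemma trimmed_first_piece i x z : conj_trimmed adj (x ++ z) ->
  exists2 r, conj_trimmed adj (x ++ lift_word (first_piece (proj adj i z)) ++ r)
    & None \notin proj adj i z -> forall a, a \in r -> adj i (tag a).
Proof.
elim: z x => [|[j b] z IH] x tx; first by exists [::].
have [|r tr r_adj] := IH (rcons x (existT _ j b)); first by rewrite cat_rcons.
have [ji|ji] := eqVneq j i.
  subst j; exists r; rewrite -/(Tagged (fun j => X j) b) proj_eq //=.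
  by rewrite cat_rcons in tr.
case ij: (adj i j).
  rewrite proj_adj //; exists (existT _ j b :: r).
    have ji' : adj j i by rewrite adj_sym.
    set u := first_piece _ in tr *.
    have := Op_shuffle x r [:: b] u ji'.
    by rewrite cat_rcons in tr => /(trimmed_step tr)[].
  by move=> /r_adj rP a; rewrite inE => /predU1P[->|/rP].
by rewrite proj_other ?ij //; exists (existT _ j b :: z); rewrite // inE.
Qed.

Lemma trimmed_geodesic i x u r : conj_trimmed adj (x ++ lift_word u ++ r) ->
  Gamma X i u.
Proof.
move=> tx; apply: contrapT => /(not_geodesic (@X_gen i))[w uw wu].
by have [] := trimmed_step tx (Op_local_reduction adj x r uw wu).
Qed.

(** This lets a cyclic shift of the projection be realized by a cyclic conjugation of [y]. *)
Lemma drop_proj i m y : exists k, drop m (proj adj i y) = proj adj i (drop k y).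
Proof.
elim: y m => [|[j a] y IH] m; first by exists 0.
case: m => [|m]; first by exists 0; rewrite !drop0.
have [ji|ji] := eqVneq j i.
  subst j; have [k e] := IH m; exists k.+1.
  by rewrite -/(Tagged (fun j => X j) a) proj_eq.
case ij: (adj i j); [have [k e] := IH m.+1|have [k e] := IH m]; exists k.+1.
  by rewrite proj_adj.
by rewrite proj_other ?ij.
Qed.

Lemma trimmed_proj i y : conj_trimmed adj y ->
  (cGamma_dollar X i `|` cU X i)%classic (proj adj i y).
Proof.
move=> ty; have [Ny|Ny] := boolP (None \in proj adj i y).
  right; apply/cUP; split=> // m; have [k ->] := drop_proj i m y.
  have tdt : conj_trimmed adj (drop k y ++ take k y).
    have := Op_cyclic_conjugation adj (take k y) (drop k y).
    by rewrite cat_take_drop => /(trimmed_step ty)[].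
  (* Both words start with the projections of [drop k y] and then [take k y], and together these
     contain a [$]. *)
  have -> : first_piece (proj adj i (drop k y) ++ proj adj i y) =
            first_piece (proj adj i (drop k y ++ take k y)).
    rewrite proj_cat.
    have [Nd|Nd] := boolP (None \in proj adj i (drop k y)).
      by rewrite !first_piece_cat.
    move: Ny; rewrite -{1 3}(cat_take_drop k y) proj_cat mem_cat (negPf Nd) orbF.
    by move=> Nt; rewrite catA first_piece_cat // mem_cat Nt orbT.
  by have [r /(@trimmed_geodesic i [::])] := @trimmed_first_piece i [::] _ tdt.
(* Without [$], shuffles turn [y] into a word over [X_i] followed by letters of [C_i], the shape on
   which a conjugacy reduction acts. *)
left; exists (first_piece (proj adj i y)); last exact: map_first_piece.
have [r tr r_adj] := @trimmed_first_piece i [::] _ ty.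
apply: contrapT => /(not_conj_geodesic (@X_gen i))[w uw wu].
have sub_r : Xset X i \subset Cword adj r.
  apply/fintype.subsetP => a; rewrite inE => /eqP ai.
  move: (r_adj Ny) => {tr r_adj}; elim: r => [|b r IH] rP;
    rewrite /Cword ?big_nil ?inE //.
  rewrite big_cons inE -/(Cword adj r) IH ?andbT.
    by rewrite in_Cset ai adj_sym rP // inE eqxx.
  by move=> c cr; apply: rP; rewrite inE cr orbT.
by have [] := trimmed_step tr (Op_conjugacy_reduction sub_r uw wu).
Qed.

(** * Effect of the operations on length and conjugacy class *)

Lemma gp_inj1 i : gp_inj adj (1 : G i) = 1.
Proof. exact/gp_piP/gp_one. Qed.

Lemma gp_injM i (a b : G i) :
  gp_inj adj (a * b) = gp_inj adj a * gp_inj adj b.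
Proof.
apply/esym; apply: etrans (gp_prod_pi adj [:: Tagged G a] [:: Tagged G b]) _.
exact/gp_piP/gp_mul.
Qed.

Lemma gp_injV i (a : G i) : gp_inj adj a^-1 = (gp_inj adj a)^-1.
Proof.
by apply: (mulgI (gp_inj adj a)); rewrite -gp_injM !mulgV gp_inj1.
Qed.

Lemma gp_injJ i (a b : G i) :
  gp_inj adj (a ^ b) = gp_inj adj a ^ gp_inj adj b.
Proof. by rewrite !conjgE !gp_injM gp_injV. Qed.

Lemma gp_inj_commute i j (a : G i) (b : G j) : adj i j ->
  commute (gp_inj adj a) (gp_inj adj b).
Proof.
move=> ij; apply: etrans (gp_prod_pi adj [:: Tagged G a] [:: Tagged G b]) _.
apply: etrans (esym (gp_prod_pi adj [:: Tagged G b] [:: Tagged G a])).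
exact/gp_piP/gp_comm.
Qed.

Lemma val_lift i (u : seq (X i)) : val (lift_word u) = gp_inj adj (valG i u).
Proof.
elim: u => [|x u IH]; first by rewrite /word_val !big_nil gp_inj1.
by rewrite /= !word_val_cons IH gp_injM.
Qed.

Lemma letter_generating : generating (letter_val adj X).
Proof.
elim/quotW; elim=> [|[i a] s [y ys]]; first by exists [::]; exact: big_nil.
have [w wa] := X_gen a; exists (lift_word w ++ y).
rewrite word_val_cat val_lift wa ys -[in RHS]cat1s; exact: gp_prod_pi.
Qed.

(** The inclusion bears on letters only, so [a] is first spelled over [X_i]; if [X_i] is empty, so
    is the spelling, and [a] is 1. *)
Lemma commute_Cword i (a : G i) y : Xset X i \subset Cword adj y ->
  commute (gp_inj adj a) (val y).
Proof.
move=> /fintype.subsetP iy; have [w <-] := X_gen a.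
rewrite -val_lift; apply/commute_sym.
elim: w => [|x w IH]; first by rewrite /word_val big_nil; apply: commute1.
rewrite /= word_val_cons; apply: commuteM => //; apply: commute_sym.
have: Tagged (fun j => X j) x \in Cword adj y by apply: iy; rewrite inE.
elim: y {iy IH} => [|b y IH]; first by rewrite /word_val big_nil => _; apply: commute1.
rewrite /Cword big_cons inE in_Cset => /andP[ib /IH xy].
rewrite word_val_cons; apply: commuteM => //.
by apply: gp_inj_commute; rewrite adj_sym.
Qed.

Lemma operation_size k y z : operation adj k y z ->
  size z <= size y ?= iff ~~ reducing k.
Proof.
have sizeE i (u : seq (X i)) : size (lift_word u) = size u by apply: size_map.
case=> {k y z} [y z i u w _ wu|y z i u w _ wu|y z i j u w _|y z|y i u w _ _ wu|
    y i u w _ _ wu]; rewrite !size_cat ?sizeE.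
- split; first by rewrite leq_add2l leq_add2r ltnW.
  by rewrite eqn_add2l eqn_add2r ltn_eqF.
- by rewrite wu; apply/leqif_refl.
- by rewrite (addnCA (size u)); apply/leqif_refl.
- by rewrite addnC; apply/leqif_refl.
- by rewrite wu; apply/leqif_refl.
- split; first by rewrite leq_add2r ltnW.
  by rewrite eqn_add2r ltn_eqF.
Qed.

(** Cyclic conjugation conjugates by the prefix moved to the end; in the conjugacy operations the
    conjugator lies in [G_i] and commutes with the rest of the word. *)
Lemma operation_conjugate k y z : operation adj k y z ->
  conjugate (val y) (val z).
Proof.
have same (g h : graph_prod adj G) : g = h -> conjugate g h.
  by move=> ->; exists 1; rewrite conjg1.
have conjM (h : graph_prod adj G) i (a b : G i) : conjugate a b ->
    (forall c : G i, commute (gp_inj adj c) h) ->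
  conjugate (gp_inj adj a * h) (gp_inj adj b * h).
  move=> [c ->] ch; exists (gp_inj adj c).
  rewrite conjMg gp_injJ; congr (_ * _); rewrite conjgE.
  by rewrite -ch mulKg.
case=> {k y z} [y z i u w uw _|y z i u w uw _|y z i j u w ij|y z|y i u w iy uw _|
    y i u w iy uw _]; rewrite !word_val_cat ?val_lift.
- by apply: same; rewrite uw.
- by apply: same; rewrite uw.
- by apply: same; rewrite !mulgA -(mulgA (val y)) (gp_inj_commute _ _ ij) !mulgA.
- by exists (val y); rewrite conjgE mulgA mulKg.
- by apply: conjM uw _ => c; apply: commute_Cword.
- by apply: conjM uw _ => c; apply: commute_Cword.
Qed.

Lemma conjugate_trans (K : groupType) (f g h : K) :
  conjugate f g -> conjugate g h -> conjugate f h.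
Proof. by move=> [c ->] [d ->]; exists (c * d); rewrite conjgM. Qed.

Lemma conj_geodesic_trimmed y : conj_geodesics (letter_val adj X) y ->
  conj_trimmed adj y.
Proof.
move=> gy s; elim: s y gy => [//|[k z] s IH] y gy /= [op zs].
have yz := operation_conjugate op; have [le_zy size_zy] := operation_size op.
have eq_zy : size z = size y.
  by apply/eqP; rewrite eqn_leq le_zy (conj_geodesic_le gy yz).
rewrite negb_or -size_zy eq_zy eqxx /=; apply: IH zs.
apply: (conj_geodesicP letter_generating) => u zu; rewrite eq_zy.
exact: conj_geodesic_le gy (conjugate_trans yz zu).
Qed.

(** * Retractions onto subgraph products and vertex groups *)

Definition support_in (p : pred 'I_n) y := [seq a <- y | p (tag a)].

Definition vertex_word i y : seq (X i) :=
  flatten [seq untag [::] (fun x : X i => [:: x]) a | a <- y].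

(** Deleting letters induces the retraction onto the graph product over [p]: each defining relation
    is kept or becomes trivial. *)
Lemma val_support_in p y z : val y = val z ->
  val (support_in p y) = val (support_in p z).
Proof.
rewrite !word_val_pi => /gp_piP yz; apply/gp_piP.
pose pt := fun s : syllable => p (tag s).
have filterE x : map syl (support_in p x) = filter pt (map syl x).
  by rewrite filter_map.
rewrite !filterE.
elim: yz => {y z} [i|i a b|i j a b ij|u|u v _|u v w _ uv _ vw|u u' v v' _ uv _ uv'];
  rewrite /pt /=.
- by case: (p i); [apply: gp_one|apply: gp_refl].
- by case: (p i); [apply: gp_mul|apply: gp_refl].
- by case: (p i); case: (p j); by [apply: gp_comm|apply: gp_refl].
- exact: gp_refl.
- exact: gp_sym.
- exact: gp_trans uv vw.
- by rewrite !filter_cat; apply: gp_cat.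
Qed.

Lemma val_vertex_word i y z : val y = val z ->
  valG i (vertex_word i y) = valG i (vertex_word i z).
Proof.
rewrite !word_val_pi => /gp_piP yz.
(* The retraction onto [G i] on syllable words, sending the other vertex groups to 1. *)
pose rho (u : seq syllable) := \prod_(s <- u) untag (1 : G i) id s.
have rhoE x : valG i (vertex_word i x) = rho (map syl x).
  rewrite /rho; elim: x => [|[j a] x IH]; first by rewrite /word_val !big_nil.
  rewrite /vertex_word /= word_val_cat -/(vertex_word i x) IH big_cons.
  congr (_ * _); have [ji|ji] := eqVneq j i.
    by subst j; rewrite !untag_Tagged /word_val big_seq1.
  by rewrite !untag_dflt // /word_val big_nil.
rewrite !rhoE; elim: yz => {y z} [j|j a b|j k a b jk|//|//|u v w _ -> _ -> //|
    u u' v v' _ uv _ uv']; rewrite /rho ?big_cons ?big_nil ?mulg1.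
- have [ji|ji] := eqVneq j i; first by subst j; rewrite untag_Tagged.
  by rewrite untag_dflt.
- have [ji|ji] := eqVneq j i; first by subst j; rewrite !untag_Tagged.
  by rewrite !untag_dflt ?mulg1.
- have [ji|ji] := eqVneq j i.
    subst j; rewrite untag_Tagged [untag _ _ _]untag_dflt ?mulg1 ?mul1g //.
    by rewrite eq_sym (adj_neq adj_irr).
  by rewrite untag_dflt // mulg1 mul1g.
- by rewrite !big_cat; congr (_ * _).
Qed.

Lemma conjugate_word_map (K : groupType) (Y : Type) (ev : Y -> K)
    (f : seq (letter X) -> seq Y) y z :
    {morph f : u v / u ++ v >-> u ++ v} -> f [::] = [::] ->
    (forall u v, val u = val v -> word_val ev (f u) = word_val ev (f v)) ->
  conjugate (val y) (val z) -> conjugate (word_val ev (f y)) (word_val ev (f z)).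
Proof.
move=> fM f1 fval [c zE].
have [[d dc] [d' dc']] := (letter_generating c, letter_generating c^-1).
(* [d' ++ d] has the value of the empty word, and [f] respects values. *)
have d'd : word_val ev (f d') = (word_val ev (f d))^-1.
  apply: (mulIg (word_val ev (f d))); rewrite mulVg -word_val_cat -fM.
  rewrite (fval _ [::]) ?f1 ?word_val_cat ?dc ?dc' ?mulVg ?/word_val ?big_nil //.
exists (word_val ev (f d)); rewrite conjgE -d'd -!word_val_cat -!fM.
by apply: fval; rewrite !word_val_cat dc dc' zE conjgE.
Qed.

(** * From the projections to conjugacy geodesics *)

Lemma first_piece_prefix (T : Type) (u v : seq (option T)) :
  exists s, first_piece (u ++ v) = first_piece u ++ s.
Proof.
elim: u => [|[a|] u [s IH]] /=; [by exists (first_piece v)| |by exists [::]].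
by exists s; rewrite IH.
Qed.

(** Since [v] contains [$], a [$]-free factor of the power never extends beyond the next copy of
    [v], so the cyclic condition in [cUP] governs it. *)
Lemma cU_power i v k m : cU X i v ->
  Gamma X i (first_piece (drop m (flatten (nseq k v)))).
Proof.
move=> /cUP[Nv gv]; elim: k m => [|k IH] m /=; first exact: geodesic_nil.
rewrite drop_cat; case: ltnP => _; last exact: IH.
case: k {IH} => [|k] /=.
  (* The last copy has no successor: what is read there is a prefix of the cyclic factor. *)
  rewrite cats0; have [s e] := first_piece_prefix (drop m v) v.
  by have := gv m; rewrite e; apply: geodesic_catl.
by rewrite catA first_piece_cat // mem_cat Nv orbT.
Qed.

Lemma notin_proj i y a : None \notin proj adj i y -> a \in y ->
  tag a = i \/ adj i (tag a).
Proof.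
elim: y => // b y IH Ny; rewrite inE => /predU1P[->|ay].
  have [|bi] := eqVneq (tag b) i; first by left.
  case ib: (adj i (tag b)); first by right.
  by move: Ny; rewrite proj_other ?ib // inE.
apply: IH => //; apply: contraNN Ny.
by rewrite -cat1s proj_cat mem_cat orbC => ->.
Qed.

Lemma first_piece_notin i y : (forall a, a \in y -> tag a != i) ->
  first_piece (proj adj i y) = [::].
Proof.
elim: y => // a y IH ay; have ai : tag a != i by apply: ay; rewrite inE eqxx.
case ia: (adj i (tag a)); last by rewrite proj_other ?ia.
by rewrite proj_adj // IH // => b yb; apply: ay; rewrite inE yb orbT.
Qed.

Lemma proj_support_in p i y :
    (forall a, a \in y -> ~~ p (tag a) -> adj i (tag a)) ->
  proj adj i (support_in p y) = proj adj i y.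
Proof.
elim: y => // a y IH ay /=.
have {}IH : proj adj i (support_in p y) = proj adj i y.
  by apply: IH => b yb; apply: ay; rewrite inE yb orbT.
case: ifPn => [_|pa]; last by rewrite proj_adj // ay // inE eqxx.
by rewrite -cat1s -[in RHS]cat1s !proj_cat IH.
Qed.

Lemma first_piece_vertex_word i y : None \notin proj adj i y ->
  first_piece (proj adj i y) = vertex_word i y.
Proof.
elim: y => // -[j a] y IH; rewrite /vertex_word /= -/(vertex_word i y).
have [ji|ji] := eqVneq j i.
  subst j; rewrite -/(Tagged (fun j => X j) a) proj_eq untag_Tagged inE /=.
  by move=> /IH->.
rewrite untag_dflt //; case ij: (adj i j); first by rewrite proj_adj.
by rewrite proj_other ?ij // inE.
Qed.

Lemma size_vertex_word i y : size (vertex_word i y) = count (fun a => tag a == i) y.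
Proof.
elim: y => // -[j a] y IH; rewrite /vertex_word /= size_cat -/(vertex_word i y) IH.
congr addn; have [ji|ji] := eqVneq j i; last by rewrite untag_dflt.
by subst j; rewrite untag_Tagged.
Qed.

Lemma size_support_in p y : size y =
  (size (support_in p y) + \sum_(i | ~~ p i) size (vertex_word i y))%N.
Proof.
rewrite size_filter -[LHS](count_predC (fun a : letter X => p (tag a))).
congr addn; elim: y => [|a y IH] /=; first by rewrite big1.
under eq_bigr do rewrite size_vertex_word /= -size_vertex_word.
rewrite big_split /= -IH; congr addn; case: (boolP (p (tag a))) => pa /=.
  by rewrite big1 // => i pi; case: eqP pi => // <-; rewrite pa.
rewrite (bigD1 (tag a)) //= eqxx big1 // => i /andP[_].
by rewrite eq_sym => /negPf->.
Qed.

Lemma proj_conj_geodesic y :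
    (forall i, (cGamma_dollar X i `|` cU X i)%classic (proj adj i y)) ->
  conj_geodesics (letter_val adj X) y.
Proof.
move=> yP; apply: (conj_geodesicP letter_generating) => w yw.
(* For i outside p, y lies in G_i x <C_i>, and retracting to G_i bounds the number
   of letters in X_i. The letters at the vertices of p form a word all of whose
   powers are locally geodesic. *)
pose p i := None \in proj adj i y.
rewrite (size_support_in p y) (size_support_in p w); apply: leq_add; last first.
  apply: leq_sum => i pi; have [[u gu ui]|/cUP[]] := yP i; last first.
    by move: pi; rewrite /p => /negPf->.
  have uE : u = vertex_word i y.
    rewrite -first_piece_vertex_word // -ui -[map _ _]cats0.
    by rewrite first_piece_catl cats0.
  rewrite uE in gu; apply: conj_geodesic_le gu _.
  apply: conjugate_word_map yw => // [u1 u2|]; last exact: val_vertex_word.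
  by rewrite /vertex_word map_cat flatten_cat.
apply: (geodesic_powers_min letter_generating); last first.
  apply: conjugate_word_map yw => // [u1 u2|]; last exact: val_support_in.
  exact: filter_cat.
move=> k; set v := flatten _.
suff gv : locally_geodesic v.
  apply: contrapT => /(not_geodesic letter_generating)[u vu].
  by rewrite ltnNge (locally_geodesic_min gv vu).
move=> i x z vE.
have [has_i|no_i] := boolP (has (fun a => tag a == i) (support_in p y)); last first.
  rewrite first_piece_notin; first exact: geodesic_nil.
  move=> a az; apply: contraNneq no_i => ai; apply/hasP; exists a; last by rewrite ai.
  have : a \in v by rewrite vE mem_cat az orbT.
  by case/flattenP => s; rewrite mem_nseq => /andP[_ /eqP->].
have [a + /eqP ai] := hasP has_i; rewrite mem_filter => /andP[pa ya].
(* A letter [c] is deleted when the projection at its vertex has no [$]; then [a], at vertex [i],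
   lies at the vertex of [c] or at an adjacent one. The first is excluded by [p i], so [c] lies in
   [C_i] and is invisible at [i]. *)
have projE : proj adj i (support_in p y) = proj adj i y.
  apply: proj_support_in => c yc pc; have [ac|] := notin_proj pc ya.
    by move: pc; rewrite -ac pa.
  by rewrite ai adj_sym.
have cUi : cU X i (proj adj i y).
  have [[u _ ui]|//] := yP i; by move: pa; rewrite /p ai -ui => /mapP[].
have -> : proj adj i z = drop (size (proj adj i x)) (flatten (nseq k (proj adj i y))).
  have -> : flatten (nseq k (proj adj i y)) = proj adj i v.
    by rewrite /v; elim: (k) => //= j ->; rewrite proj_cat projE.
  by rewrite vE proj_cat drop_size_cat.
exact: cU_power.
Qed.

End Letters.

Theorem proposition3p5 (n : nat) (adj : rel 'I_n)
    (adj_irr : irreflexive adj) (adj_sym : symmetric adj)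
    (G : 'I_n -> groupType) (X : forall i : 'I_n, {fset G i})
    (X_inv : forall (i : 'I_n) (x : G i), x \in X i -> (x^-1)%g \in X i)
    (X_gen : forall i : 'I_n, generating (vertex_val X i))
    (y : seq (letter X)) :
  (conj_geodesics (letter_val adj X) y <-> conj_trimmed adj y) /\
  (conj_trimmed adj y <->
     (\bigcap_(i in [set: 'I_n])
        (proj adj i @^-1` (cGamma_dollar X i `|` cU X i)))%classic y).
Proof.
have geo_trim := @conj_geodesic_trimmed n adj G adj_sym X X_gen y.
have trim_proj i := @trimmed_proj n adj G adj_irr adj_sym X X_gen i y.
have proj_geo := @proj_conj_geodesic n adj G adj_irr adj_sym X X_gen y.
split; split=> //.
- by move=> ty; apply: proj_geo => i; apply: trim_proj.
- by move=> ty i _; apply: trim_proj.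
- by move=> yP; apply/geo_trim/proj_geo => i; apply: yP.
Qed.
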